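(* Let $f$ satisfy: $f$ is symmetric about $0$; $f$ decreases monotonically on $[0,\infty)$; $f>0$ on $\mathbb{R}$; $f$ is continuous. Let $\mathbf{x}_n\in\mathbb{R}^n$ and let $s>1$ be a fixed number of mixture components. Let $\eta_{n,s}$ be a global maximizer of the log-likelihood $$L_{n,s}(\eta,\mathbf{x}_n)=\sum_{i=1}^{n}\log\Big(\sum_{j=1}^{s}\pi_j f_{a_j,\sigma_j}(x_i)\Big)$$ under the restriction $\sigma_j\ge\sigma_0$, $j=1,\dots,s$. Then for $r=1,\dots,s-1$ the $r$-components parameter breakdown point satisfies $$B_{r,n}(\eta_{n,s},\mathbf{x}_n)\le \frac{r}{n+r}.$$
   Context: $f$ is a probability density on $\mathbb{R}$ and $f_{a,\sigma}(x)=\frac1\sigma f\big(\frac{x-a}{\sigma}\big)$ for $a\in\mathbb{R}$, $\sigma>0$. The parameter is $\eta=(s,a_1,\dots,a_s,\sigma_1,\dots,\sigma_s,\pi_1,\dots,\pi_s)$ with $a_j\in\mathbb{R}$, $\sigma_j>0$, $\pi_j\ge 0$, $\sum_{j=1}^s\pi_j=1$. A constant $\sigma_0>0$ (not depending on $n$ or on the data) is fixed, and all maximizations are over parameters with $\sigma_j\ge\sigma_0$ for all $j$. The maximizer need not be unique; the result holds for any choice of global maximizer for each dataset (and each sample size), which defines a sequence of estimators $E_n(\mathbf{x}_n)=\eta_{n,s}$. Breakdown point: let $(E_n)_{n\in\mathbb{N}}$ be a sequence of estimators of $\eta$ on $\mathbb{R}^n$ for fixed $s$, let $r\le s$, and let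 $\mathbf{x}_n=(x_1,\dots,x_n)$ be a dataset for which $\hat\eta=E_n(\mathbf{x}_n)$ has $\hat\pi_j>0$ for $j=1,\dots,s$ (this is part of the definition of the breakdown point). With $\mathbb{R}^+=(0,\infty)$, the $r$-components parameter breakdown point $B_{r,n}(E_n,\mathbf{x}_n)$ is the minimum of $\frac{g}{n+g}$ over all $g\in\mathbb{N}$ such that: there exist $j_1<\dots<j_r$ in $\{1,\dots,s\}$ such that for every set $D=[\pi_{\min},1]\times C$ with $\pi_{\min}>0$ and $C\subset\mathbb{R}\times\mathbb{R}^+$ compact there is a dataset $\mathbf{x}_{n+g}=(x_1,\dots,x_n,x_{n+1},\dots,x_{n+g})$ extending $\mathbf{x}_n$ by $g$ real points, for which $\hat\eta=E_{n+g}(\mathbf{x}_{n+g})$ satisfies $(\hat\pi_j,\hat a_j,\hat\sigma_j)\notin D$ for $j=j_1,\dots,j_r$. (Minimum over the empty set is read as $+\infty$.) *)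

(* Defs.v *)
From HB Require Import structures.
From mathcomp Require Import all_boot all_order all_algebra.
From mathcomp Require Import all_classical all_reals all_analysis.

Set Implicit Arguments.
Unset Strict Implicit.
Unset Printing Implicit Defensive.

Import Order.TTheory GRing.Theory Num.Theory.
Import numFieldNormedType.Exports.

Local Open Scope classical_set_scope.
Local Open Scope ring_scope.

Definition is_density (R : realType) (f : R -> R) : Prop :=
  [/\ measurable_fun [set: R] f,
      forall x : R, 0 <= f x &
      (\int[@lebesgue_measure R]_(x in [set: R]) (f x)%:E = 1)%E].

Definition location_scale (R : realType) (f : R -> R) (a sigma : R) (x : R) : R :=
  sigma^-1 * f ((x - a) / sigma).

Record mixture_param (R : realType) (s : nat) := MixtureParam {
  loc : 'I_s -> R;
  scale : 'I_s -> R;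
  weight : 'I_s -> R;
  scale_gt0 : forall j : 'I_s, 0 < scale j;
  weight_ge0 : forall j : 'I_s, 0 <= weight j;
  weight_sum1 : \sum_(j < s) weight j = 1
}.

Definition mixture_density (R : realType) (f : R -> R) (s : nat)
    (eta : mixture_param R s) (x : R) : R :=
  \sum_(j < s) weight eta j * location_scale f (loc eta j) (scale eta j) x.

Definition log_likelihood (R : realType) (f : R -> R) (s n : nat)
    (eta : mixture_param R s) (x : 'rV[R]_n) : R :=
  \sum_(i < n) ln (mixture_density f eta (x ord0 i)).

Definition scale_restricted (R : realType) (s : nat) (sigma0 : R)
    (eta : mixture_param R s) : Prop :=
  forall j : 'I_s, sigma0 <= scale eta j.

Definition is_restricted_mle (R : realType) (f : R -> R) (s n : nat)
    (sigma0 : R) (x : 'rV[R]_n) (eta : mixture_param R s) : Prop :=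
  scale_restricted sigma0 eta /\
  forall eta' : mixture_param R s, scale_restricted sigma0 eta' ->
    log_likelihood f eta' x <= log_likelihood f eta x.

Definition estimator_seq (R : realType) (s : nat) : Type :=
  forall n : nat, 'rV[R]_n -> mixture_param R s.

(* The indices j_1 < ... < j_r are given by the r-element set J, which is
   chosen before D = [pmin, 1] x C. *)
Definition breaks_down (R : realType) (s : nat) (E : estimator_seq R s)
    (r n : nat) (x : 'rV[R]_n) (g : nat) : Prop :=
  exists J : {set 'I_s}, #|J| = r /\
    forall (pmin : R) (C : set (R * R)),
      0 < pmin -> compact C -> C `<=` [set p | 0 < p.2] ->
      exists y : 'rV[R]_g,
        let eta := E (n + g)%N (row_mx x y) in
        forall j : 'I_s, j \in J ->
          ~ ([set t : R | pmin <= t <= 1] `*` C)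
              (weight eta j, (loc eta j, scale eta j)).

(* Meaningful only when all weights of E n x are positive. Then g = 0 never
   breaks down, and since g / (n + g) is nondecreasing in g >= 1 the infimum
   is a minimum whenever the set is nonempty; it is +oo otherwise. *)
Definition breakdown_point (R : realType) (s : nat) (E : estimator_seq R s)
    (r n : nat) (x : 'rV[R]_n) : \bar R :=
  ereal_inf [set (g%:R / (n + g)%:R)%:E | g in breaks_down E r x].

(* Main.v *)
(** Call a component close to a point when its location is within [d] of it.
    Since [f] is unimodal and integrates to 1, [t * f t <= 1] for [t >= 0], so a
    component that is not close to [z] has density at most [1 / d] at [z],
    whatever its scale.  Put the [r] new points beyond [B] with gaps of at least
    [2 d].  If no component is close to one of them, the likelihood of the
    maximizer is at most [M ^ (n + r) / d]; but giving each new point its own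
    component and the old data one further component (possible because
    [r < s]) yields a likelihood that does not depend on the new points.
    Hence, for large [d], every new point has a close component, and by the gaps
    these are [r] distinct components with locations beyond [B].  Some
    [r]-element set of indices occurs for arbitrarily large [B], because there
    are finitely many. *)
Require Import Defs.
From HB Require Import structures.
From mathcomp Require Import all_boot all_order all_algebra.
From mathcomp Require Import all_classical all_reals all_analysis measurable_realfun.
From mathcomp Require Import lra.

Set Implicit Arguments.
Unset Strict Implicit.
Unset Printing Implicit Defensive.

Import Order.TTheory GRing.Theory Num.Theory.
Import numFieldNormedType.Exports.

Local Open Scope classical_set_scope.
Local Open Scope ring_scope.

(** The rectangle over [[0, t]] of height [f t] lies under the graph of [f], whose total area is
    1. *)
Lemma density_mul_le1 (R : realType) (f : R -> R) (t : R) :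
  is_density f -> (forall x y : R, 0 <= x -> x <= y -> f y <= f x) ->
  0 <= t -> t * f t <= 1.
Proof.
move=> [mf f_ge0 f_int1] f_decr t_ge0.
rewrite -lee_fin -f_int1.
have mI : measurable (`[0, t] : set R) by exact: measurable_itv.
have /measurable_EFinP mEf := mf.
apply: (@le_trans _ _ (\int[@lebesgue_measure R]_(x in `[0%R, t]) (f x)%:E)%E); last first.
  by apply: ge0_subset_integral => //= x _; rewrite lee_fin.
apply: (@le_trans _ _ (\int[@lebesgue_measure R]_(x in `[0%R, t]) (cst (f t)%:E x))%E).
  rewrite integral_cst //= lebesgue_measure_itv /= lte_fin.
  case: ltP => [_|t_le0]; first by rewrite sube0 -EFinM mulrC.
  by rewrite mule0 lee_fin (le_anti (introT andP (conj t_le0 t_ge0))) mul0r.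
apply: ge0_le_integral => //=.
- by move=> x _; rewrite lee_fin.
- exact: measurable_funS mEf.
- by move=> x; rewrite in_itv /= => /andP[x_ge0 x_le]; rewrite lee_fin f_decr.
Qed.

Section UnimodalDensity.
Variables (R : realType) (f : R -> R).
Hypotheses (f_density : is_density f)
  (f_sym : forall x : R, f (- x) = f x)
  (f_decr : forall x y : R, 0 <= x -> x <= y -> f y <= f x)
  (f_pos : forall x : R, 0 < f x).

Lemma even_abs (x : R) : f `|x| = f x.
Proof. by case: (ger0P x) => _; rewrite ?f_sym. Qed.

Lemma location_scale_gt0 (a sigma x : R) :
  0 < sigma -> 0 < location_scale f a sigma x.
Proof. by move=> sigma_gt0; rewrite mulr_gt0 ?invr_gt0. Qed.

Lemma location_scale_le_peak (sigma0 a sigma x : R) :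
  0 < sigma0 -> sigma0 <= sigma ->
  location_scale f a sigma x <= sigma0^-1 * f 0.
Proof.
move=> sigma0_gt0 sigma_ge; have sigma_gt0 := lt_le_trans sigma0_gt0 sigma_ge.
apply: ler_pM; rewrite ?invr_ge0 ?(ltW sigma_gt0) ?(ltW (f_pos _)) //.
  by rewrite lef_pV2 ?posrE.
by rewrite -even_abs f_decr.
Qed.

(** With [u = |x - a|], the bound [t * f t <= 1] at [t = u / sigma] becomes
    [sigma^-1 * f (u / sigma) <= u^-1]: the scale cancels. *)
Lemma location_scale_le_inv_dist (d a sigma x : R) :
  0 < d -> 0 < sigma -> d <= `|x - a| -> location_scale f a sigma x <= d^-1.
Proof.
move=> d_gt0 sigma_gt0 d_le; have u_gt0 := lt_le_trans d_gt0 d_le.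
apply: (@le_trans _ _ `|x - a|^-1); last by rewrite lef_pV2 ?posrE.
rewrite /location_scale -even_abs normrM normfV (gtr0_norm sigma_gt0).
rewrite -[leRHS]mulr1 -ler_pdivrMl ?invr_gt0 // invrK mulrA.
by apply: density_mul_le1 => //; rewrite divr_ge0 // ltW.
Qed.

Lemma mixture_density_le (s : nat) (eta : mixture_param R s) (x b : R) :
  (forall j, location_scale f (loc eta j) (scale eta j) x <= b) ->
  mixture_density f eta x <= b.
Proof.
move=> le_b; rewrite -[leRHS]mul1r -(weight_sum1 eta) mulr_suml.
by apply: ler_sum => j _; rewrite ler_wpM2l // weight_ge0.
Qed.

Lemma le_mixture_density (s : nat) (eta : mixture_param R s) (x : R) (j : 'I_s) :
  weight eta j * location_scale f (loc eta j) (scale eta j) x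
    <= mixture_density f eta x.
Proof.
rewrite /mixture_density (bigD1 j) //= lerDl sumr_ge0 // => k _.
by rewrite mulr_ge0 ?weight_ge0 // ltW // location_scale_gt0 // scale_gt0.
Qed.

Lemma mixture_density_gt0 (s : nat) (eta : mixture_param R s) (x : R) :
  0 < mixture_density f eta x.
Proof.
have [j w_gt0] : exists j, 0 < weight eta j.
  apply: contrapT => /forallNP no_w.
  have := weight_sum1 eta; rewrite big1 => [/eqP|j _].
    by rewrite eq_sym oner_eq0.
  apply/le_anti; rewrite weight_ge0 andbT leNgt; exact/negP.
apply: lt_le_trans (le_mixture_density _ _ j).
by rewrite mulr_gt0 // location_scale_gt0 // scale_gt0.
Qed.

Lemma le_ln (u v : R) : 0 < u -> u <= v -> ln u <= ln v.
Proof. by move=> u_gt0 uv; rewrite ler_ln ?posrE // (lt_le_trans u_gt0). Qed.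

Lemma log_likelihood_le_far (s m : nat) (sigma0 d M : R) (y : 'rV[R]_m)
    (eta : mixture_param R s) (i : 'I_m) :
  0 < sigma0 -> scale_restricted sigma0 eta -> 0 < d ->
  1 <= M -> sigma0^-1 * f 0 <= M ->
  (forall j, d <= `|y ord0 i - loc eta j|) ->
  log_likelihood f eta y <= m%:R * ln M - ln d.
Proof.
move=> sigma0_gt0 eta_restr d_gt0 M_ge1 peak_le far.
rewrite /log_likelihood (bigD1 i) //= addrC; apply: lerD; last first.
  rewrite -lnV ?posrE //; apply: le_ln; first exact: mixture_density_gt0.
  by apply: mixture_density_le => j; rewrite location_scale_le_inv_dist ?scale_gt0.
apply: (@le_trans _ _ (\sum_(k < m) ln M)); last first.
  by rewrite sumr_const card_ord mulr_natl.
(* The left sum omits [i]; since [1 <= M], adding the spare term [ln M] only weakens the bound. *)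
rewrite [leRHS](bigD1 i) //= ler_wpDl ?ln_ge0 //; apply: ler_sum => k _.
apply: le_ln; first exact: mixture_density_gt0.
apply: mixture_density_le => j; apply: le_trans peak_le.
exact: location_scale_le_peak.
Qed.

Lemma exists_fit_new_points (s n r : nat) (sigma0 : R) (x : 'rV[R]_n) :
  0 < sigma0 -> (r < s)%N ->
  exists K : R, forall y : 'rV[R]_r, exists eta : mixture_param R s,
    scale_restricted sigma0 eta /\ K <= log_likelihood f eta (row_mx x y).
Proof.
move=> sigma0_gt0 lt_rs.
have s_gt0 : 0 < (s%:R : R) by rewrite ltr0n (leq_ltn_trans _ lt_rs).
(* What one component of weight [1 / s] and scale [sigma0] contributes at displacement [z] from its
   location. *)
pose term (z : R) := s%:R^-1 * (sigma0^-1 * f (z / sigma0)).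
have term_gt0 z : 0 < term z by rewrite !mulr_gt0 ?invr_gt0.
exists (\sum_(i < n) ln (term (x ord0 i)) + \sum_(i < r) ln (term 0)) => y.
(* Component [j < r] sits on the new point [j]. The others sit at 0; component [r], which exists as
   [r < s], serves the old data. *)
pose a (j : 'I_s) : R := if insub (j : nat) is Some i then y ord0 i else 0.
have w_sum1 : \sum_(j < s) (s%:R^-1 : R) = 1.
  by rewrite sumr_const card_ord -[LHS]mulr_natr mulVf ?gt_eqF.
have w_ge0 : 0 <= (s%:R^-1 : R) by rewrite invr_ge0 ltW.
pose eta := @MixtureParam R s a (fun=> sigma0) (fun=> s%:R^-1)
  (fun=> sigma0_gt0) (fun=> w_ge0) w_sum1.
exists eta; split; first by move=> j /=.
rewrite /log_likelihood big_split_ord /=; apply: lerD; apply: ler_sum => i _.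
  rewrite row_mxEl; apply: le_ln => //.
  have := le_mixture_density eta (x ord0 i) (Ordinal lt_rs).
  by rewrite /= /a insubF ?ltnn // /location_scale subr0.
rewrite row_mxEr; apply: le_ln => //.
have := le_mixture_density eta (y ord0 i) (widen_ord (ltnW lt_rs) i).
by rewrite /= /a valK /location_scale subrr.
Qed.

End UnimodalDensity.

Lemma spread_points_inj (R : realType) (s r : nat) (B d : R) (a : 'I_s -> R)
    (h : 'I_r -> 'I_s) :
  0 < d -> (forall i : 'I_r, `|B + 2 * d * i.+1%:R - a (h i)| < d) -> injective h.
Proof.
move=> d_gt0 close i k eq_h; apply/val_inj/eqP; rewrite eqn_leq.
(* A location within [d] of two of the points would put them less than [2 * d] apart. *)
have le_ik (u v : 'I_r) : h u = h v -> (u <= v)%N.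
  move=> eq_uv; rewrite leqNgt; apply/negP => lt_vu.
  have := close u; have := close v; rewrite eq_uv !ltr_norml.
  have : (v.+1%:R + 1 <= u.+1%:R :> R) by rewrite natr1 ler_nat.
  nra.
by rewrite !le_ik.
Qed.

(** Because of [i.+1], even the first point is [B + 2 * d], so a location within [d] of any point
    exceeds [B + d]. *)
Lemma spread_points_loc_gt (R : realType) (B d a : R) (i : nat) :
  0 < d -> `|B + 2 * d * i.+1%:R - a| < d -> B < a.
Proof.
move=> d_gt0; rewrite ltr_norml.
have : (1 <= i.+1%:R :> R) by rewrite ler1n.
nra.
Qed.

Lemma uniform_index_set (R : realType) (s r : nat) (Y : Type)
    (a : Y -> 'I_s -> R) :
  (forall B, exists y, exists2 J : {set 'I_s}, #|J| = r &
     forall j, j \in J -> B < a y j) ->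
  exists2 J : {set 'I_s}, #|J| = r &
    forall B, exists y, forall j, j \in J -> B < a y j.
Proof.
move=> large; apply: contrapT => noJ.
have /choice[b bP] : forall J : {set 'I_s}, exists B, #|J| = r ->
    ~ exists y, forall j, j \in J -> B < a y j.
  move=> J; apply: contrapT => /forallNP allB; apply: noJ; exists J.
    by apply: contrapT => cardJ; apply: (allB 0).
  by move=> B; apply: contrapT => notB; apply: (allB B).
(* Beyond the largest of the finitely many thresholds [b J], the set given by [large] contradicts
   its own threshold. *)
have [y [J cardJ aJ]] := large (\big[Order.max/0]_J b J).
apply: (bP J cardJ); exists y => j jJ.
exact: le_lt_trans (le_bigmax _ _ _) (aJ j jJ).
Qed.

Lemma compact_fst_bounded (R : realType) (C : set (R * R)) :
  compact C -> exists B, forall p, C p -> p.1 <= B.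
Proof.
move=> cC; have cfst : compact (fst @` C).
  apply: continuous_compact => //; apply: continuous_subspaceT => p.
  exact: cvg_fst.
have [M [_ bndM]] := compact_bounded cfst.
exists (M + 1) => p Cp; apply: le_trans (ler_norm _) _.
by apply: bndM; [rewrite ltrDl | exists p].
Qed.

Theorem theorem4p4 (R : realType) (f : R -> R)
    (f_density : is_density f)
    (f_sym : forall x : R, f (- x) = f x)
    (f_decr : forall x y : R, 0 <= x -> x <= y -> f y <= f x)
    (f_pos : forall x : R, 0 < f x)
    (f_cont : continuous f)
    (sigma0 : R) (sigma0_gt0 : 0 < sigma0)
    (s : nat) (s_gt1 : (1 < s)%N)
    (E : estimator_seq R s)
    (E_mle : forall (m : nat) (y : 'rV[R]_m),
       is_restricted_mle f sigma0 y (E m y))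
    (n : nat) (x : 'rV[R]_n)
    (x_weights : forall j : 'I_s, 0 < weight (E n x) j)
    (r : nat) (r_range : (1 <= r <= s - 1)%N) :
  (breakdown_point E r x <= (r%:R / (n + r)%:R)%:E)%E.
Proof.
have lt_rs : (r < s)%N.
  by case/andP: r_range => _; rewrite subn1 -ltnS prednK // ltnW.
apply: ereal_inf_lbound; exists r => //.
have [J cardJ aJ] : exists2 J : {set 'I_s}, #|J| = r & forall B,
    exists y : 'rV[R]_r, forall j, j \in J ->
      B < loc (E (n + r)%N (row_mx x y)) j.
  apply: uniform_index_set => B.
  have [K fit] := exists_fit_new_points f_pos x sigma0_gt0 lt_rs.
  pose M := Num.max 1 (sigma0^-1 * f 0).
  (* Chosen so that [(n + r) * ln M - ln d = K - 1 < K]. This is not circular: [K] is fixed before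
     [y], which depends on [d]. *)
  pose d := expR ((n + r)%:R * ln M - K + 1).
  have d_gt0 : 0 < d by exact: expR_gt0.
  pose y : 'rV[R]_r := \row_i (B + 2 * d * i.+1%:R).
  exists y; set eta := E _ _.
  have [eta_restr eta_max] := E_mle _ (row_mx x y).
  have /choice[h close] : forall i : 'I_r, exists j,
      `|B + 2 * d * i.+1%:R - loc eta j| < d.
    move=> i; apply: contrapT => /forallNP far.
    have [eta' [/eta_max le_eta' le_K]] := fit y.
    have M_ge1 : 1 <= M by rewrite le_max lexx.
    have peak_le : sigma0^-1 * f 0 <= M by rewrite le_max lexx orbT.
    have := log_likelihood_le_far f_density f_sym f_decr f_pos
      (y := row_mx x y) (i := rshift n i) sigma0_gt0 eta_restr d_gt0
      M_ge1 peak_le.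
    rewrite row_mxEr mxE expRK => /(_ _)/wrap[|bound].
      by move=> j; rewrite leNgt; apply/negP/far.
    move: (le_trans le_K (le_trans le_eta' bound)); lra.
  exists [set h i | i : 'I_r]%SET.
    by rewrite card_imset ?card_ord //; exact: spread_points_inj close.
  by move=> _ /imsetP[i _ ->]; exact: spread_points_loc_gt (close i).
(* Once their locations pass the bound [B] on the locations in [C], the components in [J] leave
   [C]. *)
exists J; split => // pmin C _ /compact_fst_bounded[B bndC] _.
have [y locy] := aJ B; exists y => eta j /locy + [_ /bndC /=].
by rewrite ltNge => /negP.
Qed.
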